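(* Let $k$ be a commutative ring, let $\mathcal{T}$ be a $k$-linear triangulated category that has a strong complete generator and let $H:\mathcal{T}^{\mathrm{op}}\to k\text{-Mod}$ be a ($k$-linear) cohomological functor that commutes with products. Then $H$ is locally finitely presented if and only if it is a direct summand of a representable functor. If moreover $\mathcal{T}$ is closed under countable multiples, then $H$ is locally finitely presented if and only if it is representable.
   Context: $k\text{-Mod}$ is the category of all $k$-modules. A functor $H:\mathcal{T}^{\mathrm{op}}\to k\text{-Mod}$ is cohomological if for every distinguished triangle $X\to Y\to Z\to X[1]$ the sequence $H(Z)\to H(Y)\to H(X)$ is exact. That $H$ commutes with products means that $H$ takes products in $\mathcal{T}^{\mathrm{op}}$, i.e. direct sums that exist in $\mathcal{T}$, to products. For $C\in\mathcal{T}$, $h_C=\operatorname{Hom}_{\mathcal{T}}(-,C)$. $H$ is locally finitely generated if for every $X\in\mathcal{T}$ there are $D\in\mathcal{T}$ and a natural transformation $\alpha:h_D\to H$ such that $\alpha(X[i])$ is surjective for all $i\in\mathbb{Z}$. $H$ is locally finitely presented if it is locally finitely generated and, for every $E\in\mathcal{T}$, the kernel of any map $h_E\to H$ is locally finitely generated. For a subcategory (or object) $\mathcal{I}$ of $\mathcal{T}$, $\langle\mathcal{I}\rangle$ is the smallest full subcategory containing $\mathcal{I}$ and closed under finite direct sums, direct summands and shifts; $\overline{\mathcal{I}}$ is the smallest full subcategory containing $\mathcal{I}$ and closed under (arbitrary, existing in $\mathcal{T}$) direct sums and shifts; $\mathcal{I}_1*\mathcal{I}_2$ is the full subcategory of objects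 $M$ for which there is a distinguished triangle $M_1\to M\to M_2\to M_1[1]$ with $M_i\in\mathcal{I}_i$; $\mathcal{I}_1\diamond\mathcal{I}_2=\langle\mathcal{I}_1*\mathcal{I}_2\rangle$; $\langle\mathcal{I}\rangle_0=0$ and $\langle\mathcal{I}\rangle_i=\langle\mathcal{I}\rangle_{i-1}\diamond\langle\mathcal{I}\rangle$ for $i\ge1$. A strong complete generator of $\mathcal{T}$ is an object $G$ with $\mathcal{T}=\langle\overline{\{G\}}\rangle_d$ for some $d\in\mathbb{N}$. Closed under countable multiples means that for every object $X$ the direct sum of countably many copies of $X$ exists in $\mathcal{T}$. *)

(* Defs.v *)
From HB Require Import structures.
From mathcomp Require Import all_boot all_order all_algebra.

Set Implicit Arguments.
Unset Strict Implicit.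
Unset Printing Implicit Defensive.

Import GRing.Theory.
Local Open Scope ring_scope.

Reserved Notation "g ∘ f" (at level 40, left associativity).

Record lin_cat (k : comPzRingType) := LinCat {
  obj :> Type;
  mor : obj -> obj -> lmodType k;
  idm : forall X, mor X X;
  compm : forall X Y Z, mor Y Z -> mor X Y -> mor X Z
    where "g ∘ f" := (compm g f);
  compA : forall W X Y Z (h : mor Y Z) (g : mor X Y) (f : mor W X),
    h ∘ (g ∘ f) = (h ∘ g) ∘ f;
  comp1m : forall X Y (f : mor X Y), idm Y ∘ f = f;
  compm1 : forall X Y (f : mor X Y), f ∘ idm X = f;
  comp_linear_l : forall X Y Z (f : mor X Y),
    linear (fun g : mor Y Z => g ∘ f);
  comp_linear_r : forall X Y Z (g : mor Y Z),
    linear (fun f : mor X Y => g ∘ f)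
}.

Arguments idm {k l} X.
Arguments compm {k l X Y Z} g f.

Notation "g ∘ f" := (compm g f) : ring_scope.

Section Categories.

Variables (k : comPzRingType) (C : lin_cat k).

Definition is_iso (X Y : C) (f : mor X Y) : Prop :=
  exists g : mor Y X, g ∘ f = idm X /\ f ∘ g = idm Y.

Definition is_zero (Z : C) : Prop :=
  forall X : C, (forall f : mor X Z, f = 0) /\ (forall f : mor Z X, f = 0).

Definition is_direct_sum (I : Type) (X : I -> C) (S : C)
    (inj : forall i, mor (X i) S) : Prop :=
  forall (Y : C) (f : forall i, mor (X i) Y),
    exists! u : mor S Y, forall i, u ∘ inj i = f i.

Definition direct_sum_of (I : Type) (X : I -> C) (S : C) : Prop :=
  exists inj : forall i, mor (X i) S, is_direct_sum inj.

Definition is_summand (X S : C) : Prop :=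
  exists Y : C, direct_sum_of (fun b : bool => if b then X else Y) S.

Record lin_endofunctor := LinEndofunctor {
  fobj :> C -> C;
  fmap : forall X Y : C, {linear mor X Y -> mor (fobj X) (fobj Y)};
  fmap_id : forall X, fmap X X (idm X) = idm (fobj X);
  fmap_comp : forall X Y Z (g : mor Y Z) (f : mor X Y),
    fmap X Z (g ∘ f) = fmap Y Z g ∘ fmap X Y f
}.

(* [G \o F] is naturally isomorphic to the identity. *)
Definition quasi_retraction (F G : lin_endofunctor) : Prop :=
  exists e : forall X : C, mor (G (F X)) X,
    (forall X, is_iso (e X)) /\
    (forall X Y (f : mor X Y),
       e Y ∘ fmap G (F X) (F Y) (fmap F X Y f) = f ∘ e X).

End Categories.

Arguments fmap {k C} l {X Y}.

(* The shift is only required to be an autoequivalence, with chosen            *)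
(* quasi-inverse [unshift]; a strict automorphism is a special case.           *)
Record tri_cat (k : comPzRingType) := TriCat {
  tri_base :> lin_cat k;
  has_direct_sums : forall n (X : 'I_n -> tri_base),
    exists S, direct_sum_of X S;
  shift : lin_endofunctor tri_base;
  unshift : lin_endofunctor tri_base;
  shiftK : quasi_retraction shift unshift;
  unshiftK : quasi_retraction unshift shift;
  distinguished : forall X Y Z : tri_base,
    mor X Y -> mor Y Z -> mor Z (shift X) -> Prop;
  tri_iso : forall (X Y Z X' Y' Z' : tri_base)
      (f : mor X Y) (g : mor Y Z) (h : mor Z (shift X))
      (f' : mor X' Y') (g' : mor Y' Z') (h' : mor Z' (shift X'))
      (a : mor X X') (b : mor Y Y') (c : mor Z Z'),
    is_iso a -> is_iso b -> is_iso c ->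
    b ∘ f = f' ∘ a -> c ∘ g = g' ∘ b -> fmap shift a ∘ h = h' ∘ c ->
    distinguished f g h -> distinguished f' g' h';
  tri_id : forall X Z : tri_base, is_zero Z ->
    distinguished (idm X) (0 : mor X Z) 0;
  tri_cone : forall (X Y : tri_base) (f : mor X Y),
    exists (Z : tri_base) (g : mor Y Z) (h : mor Z (shift X)),
      distinguished f g h;
  tri_rot : forall (X Y Z : tri_base)
      (f : mor X Y) (g : mor Y Z) (h : mor Z (shift X)),
    distinguished f g h <-> distinguished g h (- fmap shift f);
  tri_morph : forall (X Y Z X' Y' Z' : tri_base)
      (f : mor X Y) (g : mor Y Z) (h : mor Z (shift X))
      (f' : mor X' Y') (g' : mor Y' Z') (h' : mor Z' (shift X'))
      (a : mor X X') (b : mor Y Y'),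
    distinguished f g h -> distinguished f' g' h' -> b ∘ f = f' ∘ a ->
    exists c : mor Z Z', c ∘ g = g' ∘ b /\ fmap shift a ∘ h = h' ∘ c;
  tri_octa : forall (X Y Z X' Y' Z' : tri_base)
      (f : mor X Y) (u : mor Y Z') (u' : mor Z' (shift X))
      (g : mor Y Z) (v : mor Z X') (v' : mor X' (shift Y))
      (w : mor Z Y') (w' : mor Y' (shift X)),
    distinguished f u u' -> distinguished g v v' ->
    distinguished (g ∘ f) w w' ->
    exists (a : mor Z' Y') (b : mor Y' X'),
      [/\ distinguished a b (fmap shift u ∘ v'),
          a ∘ u = w ∘ g, w' ∘ a = u',
          b ∘ w = v & v' ∘ b = fmap shift f ∘ w']
}.

Arguments has_direct_sums {k} t {n} X.
Arguments shift {k} t.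
Arguments unshift {k} t.
Arguments distinguished {k t X Y Z} f g h.

Section Subcategories.

Variables (k : comPzRingType) (T : tri_cat k).

Definition shiftz (X : T) (i : int) : T :=
  match i with
  | Posz n => iter n (shift T) X
  | Negz n => iter n.+1 (unshift T) X
  end.

(* Full subcategories are given by predicates on objects.                      *)
(* Closure under isomorphism follows from closure under direct sums indexed    *)
(* by one-element types.                                                       *)
Inductive thick_span (P : T -> Prop) : T -> Prop :=
| thick_span_in X of P X : thick_span P X
| thick_span_sum n (X : 'I_n -> T) S of
    (forall i, thick_span P (X i)) & direct_sum_of X S : thick_span P S
| thick_span_summand X S of thick_span P S & is_summand X S : thick_span P X
| thick_span_shift X i of thick_span P X : thick_span P (shiftz X i).

Inductive sum_closure (P : T -> Prop) : T -> Prop :=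
| sum_closure_in X of P X : sum_closure P X
| sum_closure_sum (I : Type) (X : I -> T) S of
    (forall i, sum_closure P (X i)) & direct_sum_of X S : sum_closure P S
| sum_closure_shift X i of sum_closure P X : sum_closure P (shiftz X i).

Definition star (P1 P2 : T -> Prop) (M : T) : Prop :=
  exists (M1 M2 : T) (f : mor M1 M) (g : mor M M2) (h : mor M2 (shift T M1)),
    [/\ P1 M1, P2 M2 & distinguished f g h].

Definition diamond (P1 P2 : T -> Prop) : T -> Prop := thick_span (star P1 P2).

Fixpoint thick_span_n (P : T -> Prop) (n : nat) : T -> Prop :=
  if n is m.+1 then diamond (thick_span_n P m) (thick_span P)
  else @is_zero k T.

Definition strong_complete_generator (G : T) : Prop :=
  exists d : nat, forall X : T, thick_span_n (sum_closure (eq G)) d X.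

Definition closed_under_countable_multiples : Prop :=
  forall X : T, exists S : T, direct_sum_of (fun _ : nat => X) S.

End Subcategories.

Section LinearKernel.

Variables (k : comPzRingType) (U V : lmodType k) (f : {linear U -> V}).

Definition in_lker : {pred U} := fun x => f x == 0.

Lemma in_lker_submod : submod_closed in_lker.
Proof.
split=> [|a x y]; rewrite !unfold_in /in_lker /= ?linear0 //.
by move=> /eqP fx /eqP fy; rewrite linearP fx fy scaler0 addr0.
Qed.

HB.instance Definition _ := GRing.isSubmodClosed.Build k U in_lker
  in_lker_submod.

Record lker := LKer { lker_val : U; lkerP : lker_val \in in_lker }.

HB.instance Definition _ := [isSub for lker_val].
HB.instance Definition _ := [Choice of lker by <:].
HB.instance Definition _ := [SubChoice_isSubLmodule of lker by <:].

End LinearKernel.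

Section Functors.

Variables (k : comPzRingType) (C : lin_cat k).

(* k-linear functors C^op -> k-Mod. *)
Record cofunctor := Cofunctor {
  cobj :> C -> lmodType k;
  cmap : forall X Y : C, mor X Y -> {linear cobj Y -> cobj X};
  cmap_id : forall X (x : cobj X), cmap (idm X) x = x;
  cmap_comp : forall X Y Z (g : mor Y Z) (f : mor X Y) (x : cobj Z),
    cmap (g ∘ f) x = cmap f (cmap g x);
  cmap_linear : forall X Y (a : k) (f g : mor X Y) (x : cobj Y),
    cmap (a *: f + g) x = a *: cmap f x + cmap g x
}.

Record nat_trans (F G : cofunctor) := NatTrans {
  component :> forall X : C, {linear F X -> G X};
  naturality : forall (X Y : C) (f : mor X Y) (x : F Y),
    component X (cmap F f x) = cmap G f (component Y x)
}.

Definition nat_isomorphic (F G : cofunctor) : Prop :=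
  exists (a : nat_trans F G) (b : nat_trans G F),
    forall X : C, cancel (a X) (b X) /\ cancel (b X) (a X).

Section Representable.

Variable D : C.

Definition yoneda_map (X Y : C) (f : mor X Y) (g : mor Y D) : mor X D := g ∘ f.

HB.instance Definition _ (X Y : C) (f : mor X Y) :=
  GRing.isLinear.Build k (mor Y D) (mor X D) *:%R (yoneda_map f)
    (comp_linear_l f).

Lemma yoneda_map_id X (x : mor X D) : yoneda_map (idm X) x = x.
Proof. exact: compm1. Qed.

Lemma yoneda_map_comp X Y Z (g : mor Y Z) (f : mor X Y) (x : mor Z D) :
  yoneda_map (g ∘ f) x = yoneda_map f (yoneda_map g x).
Proof. exact: compA. Qed.

Lemma yoneda_map_linear X Y (a : k) (f g : mor X Y) (x : mor Y D) :
  yoneda_map (a *: f + g) x = a *: yoneda_map f x + yoneda_map g x.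
Proof. exact: comp_linear_r. Qed.

Definition yoneda : cofunctor :=
  @Cofunctor (fun X => mor X D) (fun X Y f => yoneda_map f)
    yoneda_map_id yoneda_map_comp yoneda_map_linear.

End Representable.

Section Kernel.

Variables (F G : cofunctor) (a : nat_trans F G).

Lemma ker_map_subproof (X Y : C) (f : mor X Y) (x : lker (a Y)) :
  cmap F f (val x) \in in_lker (a X).
Proof.
case: x => x /= /eqP ax0.
by rewrite unfold_in /in_lker naturality ax0 linear0.
Qed.

Definition ker_map (X Y : C) (f : mor X Y) (x : lker (a Y)) : lker (a X) :=
  LKer (ker_map_subproof f x).

Lemma ker_map_is_linear X Y (f : mor X Y) : linear (ker_map f).
Proof. by move=> c x y; apply: val_inj; rewrite /= !linearP. Qed.

HB.instance Definition _ (X Y : C) (f : mor X Y) :=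
  GRing.isLinear.Build k (lker (a Y)) (lker (a X)) *:%R (ker_map f)
    (ker_map_is_linear f).

Lemma ker_map_id X (x : lker (a X)) : ker_map (idm X) x = x.
Proof. by apply: val_inj; apply: cmap_id. Qed.

Lemma ker_map_comp X Y Z (g : mor Y Z) (f : mor X Y) (x : lker (a Z)) :
  ker_map (g ∘ f) x = ker_map f (ker_map g x).
Proof. by apply: val_inj; apply: cmap_comp. Qed.

Lemma ker_map_linear X Y (c : k) (f g : mor X Y) (x : lker (a Y)) :
  ker_map (c *: f + g) x = c *: ker_map f x + ker_map g x.
Proof. by apply: val_inj; rewrite /= cmap_linear. Qed.

Definition ker_functor : cofunctor :=
  @Cofunctor (fun X => lker (a X)) (fun X Y f => ker_map f)
    ker_map_id ker_map_comp ker_map_linear.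

End Kernel.

Section DirectSum.

Variables F G : cofunctor.

Definition dsum_map (X Y : C) (f : mor X Y) (x : F Y * G Y) : F X * G X :=
  (cmap F f x.1, cmap G f x.2).

Lemma dsum_map_is_linear X Y (f : mor X Y) : linear (dsum_map f).
Proof. by move=> c x y; rewrite /dsum_map /= !linearP. Qed.

HB.instance Definition _ (X Y : C) (f : mor X Y) :=
  GRing.isLinear.Build k (F Y * G Y)%type (F X * G X)%type *:%R (dsum_map f)
    (dsum_map_is_linear f).

Lemma dsum_map_id X (x : F X * G X) : dsum_map (idm X) x = x.
Proof. by case: x => x y; rewrite /dsum_map !cmap_id. Qed.

Lemma dsum_map_comp X Y Z (g : mor Y Z) (f : mor X Y) (x : F Z * G Z) :
  dsum_map (g ∘ f) x = dsum_map f (dsum_map g x).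
Proof. by rewrite /dsum_map !cmap_comp. Qed.

Lemma dsum_map_linear X Y (c : k) (f g : mor X Y) (x : F Y * G Y) :
  dsum_map (c *: f + g) x = c *: dsum_map f x + dsum_map g x.
Proof. by rewrite /dsum_map !cmap_linear. Qed.

Definition dsum_functor : cofunctor :=
  @Cofunctor (fun X => (F X * G X)%type) (fun X Y f => dsum_map f)
    dsum_map_id dsum_map_comp dsum_map_linear.

End DirectSum.

Definition representable (F : cofunctor) : Prop :=
  exists D : C, nat_isomorphic F (yoneda D).

Definition summand_of_representable (F : cofunctor) : Prop :=
  exists (D : C) (F' : cofunctor),
    nat_isomorphic (dsum_functor F F') (yoneda D).

(* The canonical map from F(S) to the product of the F(X_i) is bijective. *)
Definition commutes_with_products (F : cofunctor) : Prop :=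
  forall (I : Type) (X : I -> C) (S : C) (inj : forall i, mor (X i) S),
    is_direct_sum inj ->
    forall y : (forall i, F (X i)),
      exists! x : F S, forall i, cmap F (inj i) x = y i.

End Functors.

Section Finiteness.

Variables (k : comPzRingType) (T : tri_cat k).

Definition cohomological (H : cofunctor T) : Prop :=
  forall (X Y Z : T) (f : mor X Y) (g : mor Y Z) (h : mor Z (shift T X)),
    distinguished f g h ->
    forall y : H Y, cmap H f y = 0 <-> exists z : H Z, cmap H g z = y.

Definition locally_finitely_generated (H : cofunctor T) : Prop :=
  forall X : T, exists (D : T) (a : nat_trans (yoneda D) H),
    forall (i : int) (y : H (shiftz X i)), exists x, a (shiftz X i) x = y.

Definition locally_finitely_presented (H : cofunctor T) : Prop :=
  locally_finitely_generated H /\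
  forall (E : T) (b : nat_trans (yoneda E) H),
    locally_finitely_generated (ker_functor b).

End Finiteness.

(* Main.v *)
Require Import Defs.
From HB Require Import structures.
From mathcomp Require Import all_boot all_order all_algebra.
From Stdlib Require Import ClassicalEpsilon.
(* [compA] is to mean associativity of the composition of morphisms. *)
Import Defs.

Set Implicit Arguments.
Unset Strict Implicit.
Unset Printing Implicit Defensive.

Import GRing.Theory.
Local Open Scope ring_scope.

(** By Yoneda, a transformation from h_A to H is an element x of H A, sending
    f : X -> A to H(f)x; everything below is phrased with such elements.
    Both halves of the theorem rest on the following equivalence: H is locally
    finitely presented if and only if it is a retract of some h_D.

    Assume that H is locally finitely presented and let G be the generator.
    Choose x in H A such that h_A -> H is surjective on all shifts of G.
    The kernel of h_A -> H is covered on these shifts by some h_B; if A' is the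
    cone of B -> A, exactness of H extends x to A', and the relations on the
    shifts of G, that is, the maps f with H(f)x = 0, die under A -> A'
    ([kill_relations]).  Since H and h_A turn direct sums into products,
    surjectivity and the death of relations pass from G to everything that
    direct sums, summands and shifts produce from it.  They also pass to
    extensions M of M2 by M1, at the price of one more step: along A -> A' -> A''
    a five-lemma chase treats M as soon as the first map treats M1 and the second
    treats M2 ([onto_extension], [kills_extension]).  Hence after n steps the
    n-th thickening of the generator is under control ([approximation]), and the
    d-th thickening is the whole category.  Doing this twice gives A -> A' such
    that h_A -> H is surjective and its kernel dies in h_A'.  Lifting an element
    of H to h_A and pushing it to h_A' is then a well defined section of
    h_A' -> H ([onto_kills_retract]).

    Conversely, if H is a retract of h_D, the kernel of h_E -> H is the kernel of
    the composite h_E -> h_D, which comes from a map w : E -> D; it is covered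
    by h_F for any triangle F -> E -> D -> F[1] on w ([retract_lfp]).

    Being a retract of h_D is the same as being a direct summand of it, the
    complement being the kernel of the retraction ([retract_complement]).  With
    countable multiples, the idempotent of D cut out by H splits in the
    category ([split_idempotent]), so that H itself is representable. *)

(** * Retracts and direct sums in a linear category *)

Section LinearCategory.

Variables (k : comPzRingType) (C : lin_cat k).
Implicit Types X Y Z S : C.

Lemma comp0m X Y Z (f : mor X Y) : (0 : mor Y Z) ∘ f = 0.
Proof. exact: (linear0 (yoneda_map f)). Qed.

Lemma compDm X Y Z (g g' : mor Y Z) (f : mor X Y) :
  (g + g') ∘ f = g ∘ f + g' ∘ f.
Proof. exact: (linearD (yoneda_map f)). Qed.

Lemma compBm X Y Z (g g' : mor Y Z) (f : mor X Y) :
  (g - g') ∘ f = g ∘ f - g' ∘ f.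
Proof. exact: (linearB (yoneda_map f)). Qed.

Lemma compNm X Y Z (g : mor Y Z) (f : mor X Y) : (- g) ∘ f = - (g ∘ f).
Proof. exact: (linearN (yoneda_map f)). Qed.

HB.instance Definition _ X Y Z (g : mor Y Z) :=
  GRing.isLinear.Build k (mor X Y) (mor X Z) *:%R (compm g)
    (comp_linear_r g).

Lemma compm0 X Y Z (g : mor Y Z) : g ∘ (0 : mor X Y) = 0.
Proof. exact: (linear0 (compm g)). Qed.

Lemma compmD X Y Z (g : mor Y Z) (f f' : mor X Y) :
  g ∘ (f + f') = g ∘ f + g ∘ f'.
Proof. exact: (linearD (compm g)). Qed.

Lemma compmB X Y Z (g : mor Y Z) (f f' : mor X Y) :
  g ∘ (f - f') = g ∘ f - g ∘ f'.
Proof. exact: (linearB (compm g)). Qed.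

Lemma compmN X Y Z (g : mor Y Z) (f : mor X Y) : g ∘ (- f) = - (g ∘ f).
Proof. exact: (linearN (compm g)). Qed.

(** Retracts are used in place of isomorphisms and of summands throughout: they
    compose freely, and the properties transported below all pass to retracts. *)
Definition retract X S : Prop :=
  exists (i : mor X S) (p : mor S X), p ∘ i = idm X.

Lemma retract_refl X : retract X X.
Proof. by exists (idm X), (idm X); rewrite comp1m. Qed.

Lemma retract_trans X Y Z : retract X Y -> retract Y Z -> retract X Z.
Proof.
move=> [i [p pi]] [j [q qj]]; exists (j ∘ i), (p ∘ q).
by rewrite compA -(compA p) qj compm1.
Qed.

Lemma is_iso_retract X Y (f : mor X Y) : is_iso f -> retract X Y.
Proof. by move=> [g [gf fg]]; exists f, g. Qed.

Lemma summand_retract X S : is_summand X S -> retract X S.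
Proof.
move=> [Y [inj dsS]].
have [p [pE _]] :=
  dsS X (fun b => if b return mor (if b then X else Y) X then idm X else 0).
by exists (inj true), p; apply: (pE true).
Qed.

Lemma direct_sum_mono I (X : I -> C) S (inj : forall i, mor (X i) S) Y
    (u v : mor S Y) :
  is_direct_sum inj -> (forall i, u ∘ inj i = v ∘ inj i) -> u = v.
Proof.
move=> /(_ Y (fun i => v ∘ inj i)) [w [_ wP]] uv.
by rewrite -(wP u uv) -(wP v).
Qed.

Lemma is_zero_id Z : idm Z = 0 -> is_zero Z.
Proof.
move=> Z0 X; split=> f; first by rewrite -(comp1m f) Z0 comp0m.
by rewrite -(compm1 f) Z0 compm0.
Qed.

Lemma retract_fobj (F : lin_endofunctor C) X S :
  retract X S -> retract (F X) (F S).
Proof.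
move=> [i [p pi]]; exists (fmap F i), (fmap F p).
by rewrite -fmap_comp pi fmap_id.
Qed.

Lemma quasi_retraction_faithful (F G : lin_endofunctor C) X Y
    (f g : mor X Y) :
  quasi_retraction F G -> fmap F f = fmap F g -> f = g.
Proof.
move=> [e [e_iso e_nat]] fg; have [e' [_ ee']] := e_iso X.
by rewrite -(compm1 f) -(compm1 g) -ee' !compA -!e_nat fg.
Qed.

(** The quasi-inverse [G] is faithful, so it suffices to compare images under
    [G], where conjugating [G f] by the isomorphisms G F -> 1 provides the
    preimage of [f]. *)
Lemma quasi_inverse_full (F G : lin_endofunctor C) X Y (f : mor (F X) (F Y)) :
  quasi_retraction F G -> quasi_retraction G F ->
  exists g : mor X Y, fmap F g = f.
Proof.
move=> [e [e_iso e_nat]] GF.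
have [eX' [eX'K eXK]] := e_iso X; have [eY' [eY'K eYK]] := e_iso Y.
exists (e Y ∘ fmap G f ∘ eX'); apply: (quasi_retraction_faithful GF).
rewrite -[LHS]comp1m -eY'K -compA e_nat -(compA _ eX' (e X)) eX'K compm1.
by rewrite compA eY'K comp1m.
Qed.

(** Up to isomorphism every [Y] is of the form [F (G Y)], so a family of maps
    F (X i) -> Y is the image under [F] of a family of maps X i -> G Y. *)
Lemma quasi_inverse_direct_sum (F G : lin_endofunctor C) I (X : I -> C) S :
  quasi_retraction F G -> quasi_retraction G F ->
  direct_sum_of X S -> direct_sum_of (fun i => F (X i)) (F S).
Proof.
move=> FG GF [inj injP]; exists (fun i => fmap F (inj i)) => Y f.
have [e [e_iso _]] := GF; have [e' [e'K eK]] := e_iso Y.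
have lift Z (h : mor (F Z) Y) : exists g : mor Z (G Y), e Y ∘ fmap F g = h.
  have [g gE] := quasi_inverse_full (e' ∘ h) FG GF.
  by exists g; rewrite gE compA eK comp1m.
pose g i := proj1_sig (constructive_indefinite_description _ (lift _ (f i))).
have gE i : e Y ∘ fmap F (g i) = f i.
  by rewrite /g; case: constructive_indefinite_description.
have [u [uE _]] := injP _ g; exists (e Y ∘ fmap F u); split.
  by move=> i; rewrite -compA -fmap_comp uE.
move=> v vE; have [w wE] := lift _ v; rewrite -wE; congr (_ ∘ fmap F _).
apply: (direct_sum_mono injP) => i; rewrite uE.
apply: (quasi_retraction_faithful FG).
rewrite -[LHS]comp1m -[RHS]comp1m -e'K -!compA gE -vE -wE fmap_comp.
by rewrite -!compA.
Qed.

Lemma cmap0 (F : cofunctor C) X Y (x : F Y) : cmap F (0 : mor X Y) x = 0.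
Proof.
by have := cmap_linear (-1) (0 : mor X Y) 0 x; rewrite !scaleN1r !addNr.
Qed.

Lemma cmapD (F : cofunctor C) X Y (f g : mor X Y) (x : F Y) :
  cmap F (f + g) x = cmap F f x + cmap F g x.
Proof. by have := cmap_linear 1 f g x; rewrite !scale1r. Qed.

Lemma cmapB (F : cofunctor C) X Y (f g : mor X Y) (x : F Y) :
  cmap F (f - g) x = cmap F f x - cmap F g x.
Proof.
by have := cmap_linear (-1) g f x; rewrite !scaleN1r ![- _ + _]addrC.
Qed.

Section Yoneda.

Variables (F : cofunctor C) (A : C) (x : F A).

Definition yoneda_elt (X : C) (f : yoneda A X) : F X := cmap F f x.

Lemma yoneda_elt_is_linear X : linear (@yoneda_elt X).
Proof. by move=> c f g; apply: cmap_linear. Qed.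

HB.instance Definition _ X :=
  GRing.isLinear.Build k (yoneda A X) (F X) *:%R (@yoneda_elt X)
    (@yoneda_elt_is_linear X).

Lemma yoneda_elt_natural X Y (f : mor X Y) (g : yoneda A Y) :
  yoneda_elt (cmap (yoneda A) f g) = cmap F f (yoneda_elt g).
Proof. exact: cmap_comp. Qed.

Definition yoneda_trans : nat_trans (yoneda A) F :=
  NatTrans (component := fun X => @yoneda_elt X) yoneda_elt_natural.

End Yoneda.

Lemma yonedaE (F : cofunctor C) A (a : nat_trans (yoneda A) F) X
    (f : mor X A) : a X f = cmap F f (a A (idm A)).
Proof. by rewrite -naturality /= /yoneda_map comp1m. Qed.

End LinearCategory.

(** * Retracts of functors *)

Section FunctorRetract.

Variables (k : comPzRingType) (C : lin_cat k).

Definition functor_retract (F G : cofunctor C) : Prop :=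
  exists (s : nat_trans F G) (a : nat_trans G F),
    forall X, cancel (s X) (a X).

Section Complement.

Variables (F G : cofunctor C) (s : nat_trans F G) (a : nat_trans G F).
Hypothesis sK : forall X, cancel (s X) (a X).

Definition retract_sum X (u : dsum_functor F (ker_functor a) X) : G X :=
  s X u.1 + val u.2.

Lemma retract_sum_is_linear X : linear (@retract_sum X).
Proof.
by move=> c [x1 t1] [x2 t2]; rewrite /retract_sum /= !linearP scalerDr addrACA.
Qed.

HB.instance Definition _ X :=
  GRing.isLinear.Build k (dsum_functor F (ker_functor a) X) (G X) *:%R
    (@retract_sum X) (@retract_sum_is_linear X).

Lemma retract_sum_natural X Y (f : mor X Y)
    (u : dsum_functor F (ker_functor a) Y) :
  retract_sum (cmap (dsum_functor F (ker_functor a)) f u)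
  = cmap G f (retract_sum u).
Proof. by rewrite /retract_sum /= naturality linearD. Qed.

Lemma complement_subproof X (y : G X) : y - s X (a X y) \in in_lker (a X).
Proof. by rewrite unfold_in /in_lker linearB /= sK subrr. Qed.

Definition retract_split X (y : G X) : dsum_functor F (ker_functor a) X :=
  (a X y, LKer (complement_subproof y)).

Lemma retract_split_is_linear X : linear (@retract_split X).
Proof.
move=> c x y; rewrite /retract_split; congr pair; first exact: linearP.
by apply: val_inj; rewrite /= !linearP scalerDr addrACA.
Qed.

HB.instance Definition _ X :=
  GRing.isLinear.Build k (G X) (dsum_functor F (ker_functor a) X) *:%R
    (@retract_split X) (@retract_split_is_linear X).

Lemma retract_split_natural X Y (f : mor X Y) (y : G Y) :
  retract_split (cmap G f y)
  = cmap (dsum_functor F (ker_functor a)) f (retract_split y).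
Proof.
congr pair; first exact: naturality.
by apply: val_inj; rewrite /= !naturality linearB.
Qed.

(** As for any split epimorphism of modules, [G] is the direct sum of the image
    of the section and of the kernel of the retraction. *)
Lemma retract_complement : nat_isomorphic (dsum_functor F (ker_functor a)) G.
Proof.
exists (NatTrans (component := fun X => @retract_sum X) retract_sum_natural).
exists (NatTrans (component := fun X => @retract_split X)
  retract_split_natural) => X; split=> [[x t]|y] /=; last first.
  by rewrite /retract_sum /= addrC subrK.
have at0 : a X (val t) = 0 by apply/eqP; case: t.
have ax : a X (s X x + val t) = x by rewrite linearD at0 addr0 /= sK.
congr pair => /=; first by rewrite /retract_sum /= ax.
by apply: val_inj; rewrite /= /retract_sum /= ax addrC addKr.
Qed.

End Complement.

Lemma functor_retract_of_iso (F G : cofunctor C) :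
  nat_isomorphic F G -> functor_retract F G.
Proof. by move=> [s [a sa]]; exists s, a => X; case: (sa X). Qed.

Section Composition.

Variables (E F G : cofunctor C) (b : nat_trans F G) (a : nat_trans E F).

Lemma nat_comp_natural X Y (f : mor X Y) (x : E Y) :
  (b X \o a X) (cmap E f x) = cmap G f ((b Y \o a Y) x).
Proof. by rewrite /= !naturality. Qed.

Definition nat_comp : nat_trans E G :=
  NatTrans (component := fun X => (b X \o a X : {linear _ -> _}))
    nat_comp_natural.

End Composition.

Lemma functor_retract_trans (E F G : cofunctor C) :
  functor_retract E F -> functor_retract F G -> functor_retract E G.
Proof.
move=> [s [a sK]] [t [b tK]]; exists (nat_comp t s), (nat_comp a b).
by move=> X x; rewrite /= tK sK.
Qed.

Lemma functor_retract_dsum (F G : cofunctor C) :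
  functor_retract F (dsum_functor F G).
Proof.
pose in1 X (x : F X) : dsum_functor F G X := (x, 0).
pose pr1 X (u : dsum_functor F G X) : F X := u.1.
have in1L X : linear (@in1 X).
  by move=> c x y; congr pair; rewrite /= scaler0 addr0.
have pr1L X : linear (@pr1 X) by [].
pose in1m X := GRing.isLinear.Build k _ _ *:%R (@in1 X) (in1L X).
pose pr1m X := GRing.isLinear.Build k _ _ *:%R (@pr1 X) (pr1L X).
pose in1l X : {linear F X -> dsum_functor F G X} := HB.pack (@in1 X) (in1m X).
pose pr1l X : {linear dsum_functor F G X -> F X} := HB.pack (@pr1 X) (pr1m X).
have in1n X Y (f : mor X Y) (x : F Y) :
    in1l X (cmap F f x) = cmap (dsum_functor F G) f (in1l Y x).
  by congr pair; rewrite /= linear0.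
have pr1n X Y (f : mor X Y) (u : dsum_functor F G Y) :
    pr1l X (cmap (dsum_functor F G) f u) = cmap F f (pr1l Y u) by [].
by exists (NatTrans in1n), (NatTrans pr1n).
Qed.

Lemma summand_of_representableP (F : cofunctor C) :
  summand_of_representable F <->
  exists D : C, functor_retract F (yoneda D).
Proof.
split=> [[D [F' iso]]|[D [s [a sK]]]].
  exists D; apply: functor_retract_trans (functor_retract_of_iso iso).
  exact: functor_retract_dsum.
by exists D, (ker_functor a); apply: retract_complement sK.
Qed.

End FunctorRetract.

(** * Triangles and shifts *)

Section Triangulated.

Variables (k : comPzRingType) (T : tri_cat k).
Implicit Types A D X Y Z S : T.

Lemma shift_faithful X Y (f g : mor X Y) :
  fmap (shift T) f = fmap (shift T) g -> f = g.
Proof. exact: quasi_retraction_faithful (shiftK T). Qed.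

Lemma shift_full X Y (f : mor (shift T X) (shift T Y)) :
  exists g : mor X Y, fmap (shift T) g = f.
Proof. exact: quasi_inverse_full f (shiftK T) (unshiftK T). Qed.

Lemma zero_object : exists Z : T, is_zero Z.
Proof.
have X : 'I_0 -> T by case.
have [Z [inj injP]] := has_direct_sums T X.
exists Z; apply: is_zero_id; apply: (direct_sum_mono injP) => i.
by case: i.
Qed.

Lemma fobj_zero (F : lin_endofunctor T) Z : is_zero Z -> is_zero (F Z).
Proof.
move=> Z0; apply: is_zero_id.
by rewrite -fmap_id (proj1 (Z0 Z) (idm Z)) linear0.
Qed.

Lemma shiftz_zero Z i : is_zero Z -> is_zero (shiftz Z i).
Proof.
by case: i => n Z0; rewrite /shiftz; elim: n => [|n IH] //=; apply: fobj_zero.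
Qed.

Lemma tri_comp0 X Y Z (f : mor X Y) (g : mor Y Z) (h : mor Z (shift T X)) :
  distinguished f g h -> g ∘ f = 0.
Proof.
move=> fgh; have [Z0 Z00] := zero_object.
have ff : f ∘ idm X = f ∘ idm X by [].
have [c [cE _]] := tri_morph (tri_id X Z00) fgh ff.
by rewrite -cE compm0.
Qed.

(** A map [y] killed by [f] is a morphism from the first arrow of the triangle
    to the first arrow of 0 -> D -> D -> 0; the third map completing it is the
    desired factorization. *)
Lemma yoneda_cohomological D : cohomological (yoneda D).
Proof.
move=> X Y Z f g h fgh y; split=> [yf0|[z <-]]; last first.
  by rewrite /= /yoneda_map -compA (tri_comp0 fgh) compm0.
have [Z0 Z00] := zero_object.
have ztri : distinguished (0 : mor Z0 D) (idm D) (0 : mor D (shift T Z0)).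
  apply/tri_rot; rewrite linear0 oppr0.
  exact/tri_id/fobj_zero.
have sq : y ∘ f = (0 : mor Z0 D) ∘ (0 : mor X Z0).
  by rewrite comp0m; exact: yf0.
have [z [zE _]] := tri_morph fgh ztri sq.
by exists z; rewrite /= /yoneda_map zE comp1m.
Qed.

(** Dual to the exactness of Hom(-, D): the triangle is compared with
    W -> 0 -> W[1], which gives the lift after one shift. *)
Lemma tri_lift W X Y Z (f : mor X Y) (g : mor Y Z) (h : mor Z (shift T X))
    (w : mor W Y) :
  distinguished f g h -> g ∘ w = 0 -> exists v : mor W X, w = f ∘ v.
Proof.
move=> fgh gw0; have [Z0 Z00] := zero_object.
have wtri := proj1 (tri_rot _ _ _) (tri_id W Z00).
have sq : (0 : mor Z0 Z) ∘ (0 : mor W Z0) = g ∘ w by rewrite comp0m gw0.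
have [c [_ cE]] := tri_morph wtri (proj1 (tri_rot _ _ _) fgh) sq.
have [v vE] := shift_full c; exists v; apply: shift_faithful.
apply: oppr_inj; move: cE.
by rewrite fmap_id compmN compm1 compNm -vE -fmap_comp.
Qed.

(** The axiom rotates in both directions only among triangles whose third object
    is literally a shift; here [Z] is replaced by the isomorphic object
    obtained by unshifting and shifting. *)
Lemma tri_unrot X Y Z (f : mor X Y) (g : mor Y Z) (h : mor Z (shift T X)) :
  distinguished f g h ->
  exists (t : mor (unshift T Z) X) (h' : mor Y (shift T (unshift T Z))),
    distinguished t f h'.
Proof.
move=> fgh; have [e [e_iso _]] := unshiftK T.
have [e' [e'K eK]] := e_iso Z.
have [t tE] := shift_full (- (h ∘ e Z)); exists t, (e' ∘ g).
apply/tri_rot; rewrite tE opprK.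
apply: (tri_iso (a := idm X) (b := idm Y) (c := e')) fgh.
- by exists (idm X); rewrite !comp1m.
- by exists (idm Y); rewrite !comp1m.
- by exists (e Z).
- by rewrite comp1m compm1.
- by rewrite compm1.
- by rewrite fmap_id comp1m -compA eK compm1.
Qed.

(** Keeping the maps existential makes the signs created by rotation harmless. *)
Definition triangle X Y Z : Prop :=
  exists (f : mor X Y) (g : mor Y Z) (h : mor Z (shift T X)),
    distinguished f g h.

Lemma triangle_rot X Y Z : triangle X Y Z -> triangle Y Z (shift T X).
Proof.
by move=> [f [g [h /tri_rot fgh]]]; exists g, h, (- fmap (shift T) f).
Qed.

Lemma triangle_unrot X Y Z : triangle X Y Z -> triangle (unshift T Z) X Y.
Proof.
by move=> [f [g [h /tri_unrot [t [h' th]]]]]; exists t, f, h'.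
Qed.

Lemma triangle_shiftz X Y Z i :
  triangle X Y Z -> triangle (shiftz X i) (shiftz Y i) (shiftz Z i).
Proof.
have sh X' Y' Z' : triangle X' Y' Z' ->
    triangle (shift T X') (shift T Y') (shift T Z').
  by move=> /triangle_rot/triangle_rot/triangle_rot.
have ush X' Y' Z' : triangle X' Y' Z' ->
    triangle (unshift T X') (unshift T Y') (unshift T Z').
  by move=> /triangle_unrot/triangle_unrot/triangle_unrot.
by case: i => n t; rewrite /shiftz; elim: n => [|n IH] /=; auto.
Qed.

Lemma retract_shiftz X S i : retract X S -> retract (shiftz X i) (shiftz S i).
Proof.
case: i => n r; rewrite /shiftz; elim: n => [|n IH] //=.
all: exact: retract_fobj.
Qed.

Lemma direct_sum_shiftz I (X : I -> T) S i :
  direct_sum_of X S -> direct_sum_of (fun j => shiftz (X j) i) (shiftz S i).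
Proof.
have sK := shiftK T; have uK := unshiftK T.
case: i => n dsS; rewrite /shiftz; elim: n => [|n IH] //=.
- exact: quasi_inverse_direct_sum sK uK IH.
- exact: quasi_inverse_direct_sum uK sK dsS.
- exact: quasi_inverse_direct_sum uK sK IH.
Qed.

Lemma retract_shift_shiftz X i :
  retract (shift T (shiftz X i)) (shiftz X (i + 1)).
Proof.
have [e [e_iso _]] := unshiftK T.
case: i => [n|[|n]]; first by rewrite -PoszD addn1; apply: retract_refl.
  exact: is_iso_retract (e_iso _).
have -> : Negz n.+1 + 1 = Negz n.
  by rewrite !NegzE -[n.+2]addn1 PoszD opprD addrNK.
exact: is_iso_retract (e_iso _).
Qed.

Lemma retract_unshift_shiftz X i :
  retract (unshift T (shiftz X i)) (shiftz X (i - 1)).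
Proof.
have [e [e_iso _]] := shiftK T.
case: i => [[|n]|n]; first exact: retract_refl.
  have -> : Posz n.+1 - 1 = Posz n by rewrite -addn1 PoszD addrK.
  exact: is_iso_retract (e_iso _).
have -> : Negz n - 1 = Negz n.+1 by rewrite !NegzE -[n.+2]addn1 PoszD opprD.
exact: retract_refl.
Qed.

(** The two sides are isomorphic, but since [shift] is only an autoequivalence
    they differ when [i] and [j] have opposite signs. *)
Lemma retract_shiftz_shiftz X i j :
  retract (shiftz (shiftz X i) j) (shiftz X (i + j)).
Proof.
case: j => n; elim: n => [|n IH].
- by rewrite addr0; apply: retract_refl.
- apply: retract_trans (retract_fobj (shift T) IH) _.
  by rewrite -addn1 PoszD addrA; apply: retract_shift_shiftz.
- exact: retract_unshift_shiftz.
- apply: retract_trans (retract_fobj (unshift T) IH) _.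
  have -> : i + Negz n.+1 = i + Negz n - 1.
    by rewrite -addrA !NegzE -[n.+2]addn1 PoszD opprD.
  exact: retract_unshift_shiftz.
Qed.

(** Transport of a property from a generating class to its closures; used for
    both surjectivity and the death of relations. *)
Section ShiftStable.

Variable Q : T -> Prop.

Definition sum_stable : Prop := forall I (X : I -> T) S,
  direct_sum_of X S -> (forall i, Q (X i)) -> Q S.

Definition retract_stable : Prop := forall X S, retract X S -> Q S -> Q X.

Definition all_shifts (X : T) : Prop := forall i, Q (shiftz X i).

Hypotheses (Qsum : sum_stable) (Qretract : retract_stable).

Lemma all_shifts_shiftz X i : all_shifts X -> all_shifts (shiftz X i).
Proof. by move=> QX j; apply: Qretract (retract_shiftz_shiftz X i j) _. Qed.

Lemma all_shifts_sum I (X : I -> T) S :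
  direct_sum_of X S -> (forall i, all_shifts (X i)) -> all_shifts S.
Proof.
by move=> /direct_sum_shiftz dsS QX i; apply: Qsum (dsS i) _ => j; apply: QX.
Qed.

Lemma all_shifts_sum_closure (P : T -> Prop) X :
  (forall Y, P Y -> all_shifts Y) -> sum_closure P X -> all_shifts X.
Proof.
move=> PQ; elim=> {X} [X /PQ //|I X S _ QX dsS|X i _].
  exact: all_shifts_sum dsS QX.
exact: all_shifts_shiftz.
Qed.

Lemma all_shifts_thick_span (P : T -> Prop) X :
  (forall Y, P Y -> all_shifts Y) -> thick_span P X -> all_shifts X.
Proof.
move=> PQ; elim=> {X} [X /PQ //|n X S _ QX dsS|X S _ QS XS|X i _].
- exact: all_shifts_sum dsS QX.
- by move=> i; apply: Qretract (retract_shiftz i (summand_retract XS)) _.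
- exact: all_shifts_shiftz.
Qed.

End ShiftStable.

(** * Approximation of a locally finitely presented functor *)

Section Approximation.

Variable H : cofunctor T.

(** Surjectivity at [X] of the transformation from Hom(-, A) to [H] given
    by [x]. *)
Definition onto A (x : H A) X : Prop :=
  forall y : H X, exists f : mor X A, cmap H f x = y.

(** At [X], the kernel of the transformation given by [x] dies along [m]. *)
Definition kills A A' (x : H A) (m : mor A A') X : Prop :=
  forall f : mor X A, cmap H f x = 0 -> m ∘ f = 0.

Lemma onto_cmap A A' (x' : H A') (m : mor A A') X :
  onto (cmap H m x') X -> onto x' X.
Proof.
by move=> xX y; have [f <-] := xX y; exists (m ∘ f); rewrite cmap_comp.
Qed.

Lemma onto_retract A (x : H A) : retract_stable (onto x).
Proof.
move=> X S [i [p pi]] xS y; have [f fE] := xS (cmap H p y).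
by exists (f ∘ i); rewrite cmap_comp fE -cmap_comp pi cmap_id.
Qed.

Lemma kills_retract A A' (x : H A) (m : mor A A') : retract_stable (kills x m).
Proof.
move=> X S [i [p pi]] mS f fx0.
rewrite -(compm1 f) -pi !compA -(compA m) (mS (f ∘ p)) ?comp0m //.
by rewrite cmap_comp fx0 linear0.
Qed.

Lemma kills_sum A A' (x : H A) (m : mor A A') : sum_stable (kills x m).
Proof.
move=> I X S [inj injP] mX f fx0.
apply: (direct_sum_mono injP) => i; rewrite comp0m -compA.
by apply: mX; rewrite cmap_comp fx0 linear0.
Qed.

Lemma zero_cofunctor Z (y : H Z) : is_zero Z -> y = 0.
Proof. by move=> Z0; rewrite -(cmap_id y) (proj1 (Z0 Z) (idm Z)) cmap0. Qed.

Lemma onto_zero A (x : H A) Z : is_zero Z -> onto x Z.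
Proof. by move=> Z0 y; exists 0; rewrite cmap0 (zero_cofunctor y Z0). Qed.

Lemma kills_zero A A' (x : H A) (m : mor A A') Z : is_zero Z -> kills x m Z.
Proof. by move=> Z0 f _; rewrite (proj2 (Z0 A) f) compm0. Qed.

Hypothesis Hprod : commutes_with_products H.

Lemma onto_sum A (x : H A) : sum_stable (onto x).
Proof.
move=> I X S [inj injP] xX y.
pose g i := constructive_indefinite_description _ (xX i (cmap H (inj i) y)).
have [f [fE _]] := injP A (fun i => sval (g i)); exists f.
have [z [_ zP]] := Hprod injP (fun i => cmap H (inj i) y).
rewrite -(zP y) // -(zP (cmap H f x)) // => i.
by rewrite -cmap_comp fE; case: (g i).
Qed.

Lemma onto_generated G A (x : H A) X :
  all_shifts (onto x) G -> thick_span (sum_closure (eq G)) X ->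
  all_shifts (onto x) X.
Proof.
have [ons onr] := (onto_sum (x := x), onto_retract (x := x)).
move=> xG; apply: (all_shifts_thick_span ons onr) => Y.
by apply: (all_shifts_sum_closure ons onr) => _ <-.
Qed.

Lemma kills_generated G A A' (x : H A) (m : mor A A') X :
  all_shifts (kills x m) G -> thick_span (sum_closure (eq G)) X ->
  all_shifts (kills x m) X.
Proof.
have kis := kills_sum (x := x) (m := m).
have kir := kills_retract (x := x) (m := m).
move=> xG; apply: (all_shifts_thick_span kis kir) => Y.
by apply: (all_shifts_sum_closure kis kir) => _ <-.
Qed.

Hypothesis Hcoh : cohomological H.

(** Chase: lift the restriction of [z] to [Y]; the lift becomes trivial on [X]
    after [m], so it extends to [Z], and the error of this extension comes from
    H(X[1]), where it can be lifted again. *)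
Lemma onto_extension A A' (x' : H A') (m : mor A A') X Y Z
    (f : mor X Y) (g : mor Y Z) (h : mor Z (shift T X)) :
  distinguished f g h -> onto (cmap H m x') Y -> kills (cmap H m x') m X ->
  onto x' (shift T X) -> onto x' Z.
Proof.
move=> fgh xY mX x'SX z; have [w wE] := xY (cmap H g z).
have /(yoneda_cohomological fgh) [v vE] : m ∘ w ∘ f = 0.
  rewrite -compA mX // cmap_comp wE -cmap_comp.
  by rewrite (tri_comp0 fgh) cmap0.
have {}vE : v ∘ g = m ∘ w := vE.
have /(Hcoh (proj1 (tri_rot _ _ _) fgh)) [t tE] :
    cmap H g (z - cmap H v x') = 0.
  by rewrite linearB /= -cmap_comp vE cmap_comp wE subrr.
have [u uE] := x'SX t; exists (v + u ∘ h).
by rewrite cmapD cmap_comp uE tE addrC subrK.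
Qed.

(** Chase: after [m], a relation [w] on [Y] dies on [X] and hence factors
    through [Z]; correcting the factor by a map that comes from X[1] turns it into
    a relation on [Z], which [m'] kills. *)
Lemma kills_extension A A' A'' (x' : H A') (m : mor A A') (m' : mor A' A'')
    X Y Z (f : mor X Y) (g : mor Y Z) (h : mor Z (shift T X)) :
  distinguished f g h -> kills (cmap H m x') m X -> onto x' (shift T X) ->
  kills x' m' Z -> kills (cmap H m x') (m' ∘ m) Y.
Proof.
move=> fgh mX x'SX m'Z w wx0.
have /(yoneda_cohomological fgh) [v vE] : m ∘ w ∘ f = 0.
  by rewrite -compA mX // cmap_comp wx0 linear0.
have {}vE : v ∘ g = m ∘ w := vE.
have ghf := proj1 (tri_rot _ _ _) fgh.
have /(Hcoh ghf) [t tE] : cmap H g (cmap H v x') = 0.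
  by rewrite -cmap_comp vE cmap_comp.
have [u uE] := x'SX t.
have m'v : m' ∘ (v - u ∘ h) = 0.
  by apply: m'Z; rewrite cmapB cmap_comp uE tE subrr.
have -> : m' ∘ m ∘ w = m' ∘ (v - u ∘ h) ∘ g.
  by rewrite -!compA compBm -!compA (tri_comp0 ghf) compm0 subr0 vE.
by rewrite m'v comp0m.
Qed.

Hypothesis Hlfp : locally_finitely_presented H.

(** The new object is the cone of a map that covers the kernel on the shifts of
    [G]; [x] extends to it because its restriction along that map is zero. *)
Lemma kill_relations G A (x : H A) :
  exists (A' : T) (x' : H A') (m : mor A A'),
    cmap H m x' = x /\ all_shifts (kills x m) G.
Proof.
have [B [b bP]] := (proj2 Hlfp) A (yoneda_trans x) G.
pose r : mor B A := val (b B (idm B)).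
have rx0 : cmap H r x = 0 by rewrite /r; case: (b B _) => f /= /eqP.
have [A' [m [h rmh]]] := tri_cone r.
have [x' x'E] := proj1 (Hcoh rmh x) rx0.
exists A', x', m; split=> // i f /eqP fx0.
have [v vE] := bP i (LKer (fx0 : f \in in_lker (yoneda_trans x (shiftz G i)))).
have -> : f = r ∘ v.
  by have := congr1 val vE; rewrite yonedaE /= => <-.
by rewrite compA (tri_comp0 rmh) comp0m.
Qed.

(** The induction adds one cone per thickening.  The class of the shifts of [G]
    is handled by the last map alone, which is what [M2] needs, while the previous
    maps handle [M1]. *)
Lemma approximation G n A (x : H A) :
  all_shifts (onto x) G ->
  exists (A' : T) (x' : H A') (m : mor A A'),
    [/\ cmap H m x' = x, all_shifts (onto x') G &
      forall X, thick_span_n (sum_closure (eq G)) n X ->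
        all_shifts (onto x') X /\ all_shifts (kills x m) X].
Proof.
move=> xG; elim: n => [|n [A' [x' [m [mE x'G IH]]]]].
  exists A, x, (idm A); split=> // [|X X0]; first exact: cmap_id.
  have X0i i : is_zero (shiftz X i) by exact: shiftz_zero.
  by split=> i; [apply: onto_zero|apply: kills_zero].
have [A'' [x'' [m' [m'E m'G]]]] := kill_relations G x'.
have x''_of Y : onto x' Y -> onto x'' Y by rewrite -m'E; apply: onto_cmap.
have x''G : all_shifts (onto x'') G by move=> i; apply: x''_of.
exists A'', x'', (m' ∘ m); split=> //; first by rewrite cmap_comp m'E.
have star_ext M : star (thick_span_n (sum_closure (eq G)) n)
    (thick_span (sum_closure (eq G))) M ->
    all_shifts (onto x'') M /\ all_shifts (kills x (m' ∘ m)) M.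
  move=> [M1 [M2 [f [g [h [/IH [x'M1 mM1] M2G fgh]]]]]].
  have m'M2 := kills_generated m'G M2G.
  have x''M2 := onto_generated x''G M2G.
  have tri i : triangle (shiftz M1 i) (shiftz M i) (shiftz M2 i).
    by apply: triangle_shiftz; exists f, g, h.
  split=> i.
    (* The chase for surjectivity at [M] takes place in the triangle
       M2[-1] -> M1 -> M -> M2. *)
    have [f1 [g1 [h1 tri1]]] := triangle_unrot (tri i).
    have [e [e_iso _]] := unshiftK T.
    apply: (onto_extension (m := m') tri1); rewrite ?m'E //.
      apply: kills_retract (retract_unshift_shiftz M2 i) _; exact: m'M2.
    by apply: onto_retract (is_iso_retract (e_iso _)) _; apply: x''M2.
  have [f1 [g1 [h1 tri1]]] := tri i; rewrite -mE.
  apply: (kills_extension tri1); rewrite ?mE //.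
  by apply: onto_retract (retract_shift_shiftz M1 i) _; apply: x'M1.
move=> X XP; split.
  apply: (all_shifts_thick_span (onto_sum (x := x''))
    (onto_retract (x := x''))) XP => M.
  by case/star_ext.
apply: (all_shifts_thick_span (kills_sum (x := x) (m := m' ∘ m))
  (kills_retract (x := x) (m := m' ∘ m))) XP => M.
by case/star_ext.
Qed.

End Approximation.

(** The section lifts [y : H X] to a map X -> A and composes with [m].  Two lifts
    differ by an element of the kernel, which [m] kills: so the section does
    not depend on the lift, and is linear and natural for the same reason. *)
Lemma onto_kills_retract (H : cofunctor T) A A' (x' : H A') (m : mor A A') :
  (forall X, onto (cmap H m x') X) -> (forall X, kills (cmap H m x') m X) ->
  functor_retract H (yoneda A').
Proof.
set x := cmap H m x' => xX mX.
pose lift X y := sval (constructive_indefinite_description _ (xX X y)).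
have liftE X y : cmap H (lift X y) x = y.
  by rewrite /lift; case: (constructive_indefinite_description _ (xX X y)).
have m_eq X (f g : mor X A) : cmap H f x = cmap H g x -> m ∘ f = m ∘ g.
  move=> fg; apply/eqP; rewrite -subr_eq0 -compmB; apply/eqP/mX.
  by rewrite cmapB fg subrr.
pose s X (y : H X) : yoneda A' X := m ∘ lift X y.
have sL X : linear (s X).
  move=> c y z; rewrite /s -linearP; apply: m_eq.
  by rewrite cmap_linear !liftE.
pose sm X := GRing.isLinear.Build k _ _ *:%R (s X) (sL X).
pose sl X : {linear H X -> yoneda A' X} := HB.pack (s X) (sm X).
have sn X Y (f : mor X Y) (y : H Y) :
    sl X (cmap H f y) = cmap (yoneda A') f (sl Y y).
  rewrite /= /yoneda_map /s -compA; apply: m_eq.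
  by rewrite cmap_comp !liftE.
exists (NatTrans sn), (yoneda_trans x') => X y.
by rewrite /= /yoneda_elt /s cmap_comp liftE.
Qed.

(** The approximation is run twice because the first run yields surjectivity
    only at its end, while a section needs every relation of an object that is
    already surjective to die. *)
Lemma lfp_retract (H : cofunctor T) :
  (exists G : T, strong_complete_generator G) ->
  cohomological H -> commutes_with_products H ->
  locally_finitely_presented H ->
  exists D : T, functor_retract H (yoneda D).
Proof.
move=> [G [d Gd]] Hcoh Hprod Hlfp.
have [A0 [a0 a0P]] := (proj1 Hlfp) G.
have x0G : all_shifts (onto (a0 A0 (idm A0))) G.
  by move=> i y; have [f <-] := a0P i y; exists f; rewrite -yonedaE.
have [A [x [m0 [_ xG xP]]]] := approximation Hprod Hcoh Hlfp d x0G.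
have [A' [x' [m [mE _ mP]]]] := approximation Hprod Hcoh Hlfp d xG.
exists A'; apply: (@onto_kills_retract _ A A' x' m) => X; rewrite mE.
  exact: (proj1 (xP X (Gd X)) 0).
exact: (proj2 (mP X (Gd X)) 0).
Qed.

(** Since [H] embeds into Hom(-, D), the kernel of a transformation from
    Hom(-, E) to [H] is the kernel of composition with a map E -> D, and a
    triangle on that map presents it. *)
Lemma retract_lfp (H : cofunctor T) D :
  functor_retract H (yoneda D) -> locally_finitely_presented H.
Proof.
move=> [s [a sK]]; split=> [X|E b X].
  by exists D, a => i y; exists (s (shiftz X i) y); rewrite sK.
pose w : mor E D := s E (b E (idm E)).
have wE Y (f : mor Y E) : w ∘ f = s Y (b Y f).
  by rewrite yonedaE naturality.
have [K [g [h /tri_unrot [v [h' vwh]]]]] := tri_cone w.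
have v_ker : (v : yoneda E _) \in in_lker (b (unshift T K)).
  rewrite unfold_in /in_lker -[b _ _](sK _) -wE (tri_comp0 vwh).
  by rewrite linear0.
exists (unshift T K), (yoneda_trans (F := ker_functor b) (LKer v_ker)).
move=> i [f f_ker].
have wf0 : w ∘ f = 0 by rewrite wE (eqP f_ker) linear0.
have [u uE] := tri_lift vwh wf0; exists u.
by apply: val_inj; rewrite /= /yoneda_map uE.
Qed.

(** * Splitting of idempotents and representability *)

Section IdempotentSplitting.

Variables (A S : T) (inj : nat -> mor A S) (e : mor A A).
Hypotheses (injP : is_direct_sum inj) (ee : e ∘ e = e).

(** A splitting of [e] would be the colimit of the sequence A -> A -> A -> ... of
    copies of [e], whose telescope is the cone of [phi], the identity minus the
    shift composed with [e], on the sum [S] of countably many copies of [A].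
    On the part of [S] where [e] is the identity, [phi] is the identity minus the
    shift and is inverted, up to the zeroth copy, by minus the sum over the
    previous indices; on the part where [e] vanishes it is the identity.  This
    explains the retraction [r], and the complementary idempotent [1 - phi r] is
    the composite of [p : S -> A] (equal to [e] on each copy) with the zeroth
    inclusion.  So the cone of [phi] splits an idempotent of [S] whose image is
    also that of [e]. *)
Lemma split_idempotent :
  exists (D : T) (u : mor D A) (v : mor A D), u ∘ v = e /\ v ∘ u = idm D.
Proof.
have [p [pE _]] := injP (fun=> e).
have [phi [phiE _]] := injP (fun n => inj n - inj n.+1 ∘ e).
pose below n : mor A S := \sum_(m < n) inj m ∘ e.
have [r [rE _]] := injP (fun n => inj n - inj n ∘ e - below n).
have below_e n : below n ∘ e = below n.
  elim: n => [|n IH]; first by rewrite /below big_ord0 comp0m.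
  by rewrite /below big_ord_recr /= -/(below n) compDm IH -compA ee.
have r_phi : r ∘ phi = idm S.
  apply: (direct_sum_mono injP) => n.
  rewrite -compA phiE comp1m compmB rE compA rE !compBm below_e -!compA !ee.
  rewrite subrr sub0r opprK /below big_ord_recr /= -/(below n).
  by rewrite addrA !subrK.
have phi_below n : phi ∘ below n = inj 0 ∘ e - inj n ∘ e.
  elim: n => [|n IH]; first by rewrite /below big_ord0 compm0 subrr.
  rewrite /below big_ord_recr /= -/(below n) compmD IH compA phiE compBm.
  by rewrite -!compA ee addrA subrK.
have phi_r : phi ∘ r = idm S - inj 0 ∘ p.
  apply: (direct_sum_mono injP) => n.
  rewrite -compA rE !compmB phi_below compBm comp1m -compA pE compA phiE.
  by rewrite compBm -compA ee !opprB !addrA !subrK.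
have [D [q [h phiqh]]] := tri_cone phi.
(* [phi] is a split monomorphism, so the connecting map vanishes. *)
have h0 : h = 0.
  have := tri_comp0 (proj1 (tri_rot _ _ _) (proj1 (tri_rot _ _ _) phiqh)).
  rewrite compNm => /eqP; rewrite oppr_eq0 => /eqP hphi.
  by rewrite -(comp1m h) -fmap_id -r_phi fmap_comp -compA hphi compm0.
have q_epi W (t t' : mor D W) : t ∘ q = t' ∘ q -> t = t'.
  move=> tq; apply/eqP; rewrite -subr_eq0; apply/eqP.
  have tq0 : (t - t') ∘ q = 0 by rewrite compBm tq subrr.
  have [z <-] := proj1 (yoneda_cohomological
    (proj1 (tri_rot _ _ _) phiqh) _) tq0.
  by rewrite /= /yoneda_map h0 compm0.
have [j jE] : exists j, j ∘ q = inj 0 ∘ p.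
  have e0 : inj 0 ∘ p ∘ phi = 0.
    have -> : inj 0 ∘ p = idm S - phi ∘ r by rewrite phi_r subKr.
    by rewrite compBm comp1m -compA r_phi compm1 subrr.
  have [j jE] := proj1 (yoneda_cohomological phiqh _) e0.
  by exists j.
have qj : q ∘ j = idm D.
  apply: q_epi; rewrite -compA jE comp1m -[RHS]subr0.
  have <- : q ∘ (phi ∘ r) = 0 by rewrite compA (tri_comp0 phiqh) comp0m.
  by rewrite phi_r compmB compm1 subKr.
exists D, (p ∘ j), (q ∘ inj 0); split.
  by rewrite compA -(compA p) jE compA pE -compA pE ee.
by rewrite compA -(compA q) -jE -compA -(compA j) qj compm1.
Qed.

End IdempotentSplitting.

(** The object splitting the idempotent that [H] defines on [A] represents [H]. *)
Lemma retract_representable (H : cofunctor T) A :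
  closed_under_countable_multiples T -> functor_retract H (yoneda A) ->
  representable H.
Proof.
move=> mulT [s [a sK]]; have [S [inj injP]] := mulT A.
pose e : mor A A := s A (a A (idm A)).
have eE X (f : mor X A) : e ∘ f = s X (a X f).
  by rewrite (yonedaE a) naturality.
have ee : e ∘ e = e by rewrite eE {1}/e sK.
have [D [u [v [uv vu]]]] := split_idempotent injP ee.
exists D, (nat_comp (yoneda_trans (v : yoneda D A)) s).
exists (nat_comp a (yoneda_trans (u : yoneda A D))) => X; split=> [y|f] /=.
  by rewrite /yoneda_elt /= /yoneda_map compA uv eE !sK.
rewrite /yoneda_elt /= /yoneda_map -eE -uv -!compA.
by rewrite compA vu comp1m compA vu comp1m.
Qed.

End Triangulated.

Theorem theorem4p20 (k : comPzRingType) (T : tri_cat k)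
    (hT : exists G : T, strong_complete_generator G)
    (H : cofunctor T)
    (hcoh : cohomological H)
    (hprod : commutes_with_products H) :
  (locally_finitely_presented H <-> summand_of_representable H) /\
  (closed_under_countable_multiples T ->
     (locally_finitely_presented H <-> representable H)).
Proof.
have lfpP : locally_finitely_presented H <->
    exists D : T, functor_retract H (yoneda D).
  by split=> [|[D /retract_lfp //]]; apply: lfp_retract.
split=> [|mulT]; first by rewrite summand_of_representableP.
rewrite lfpP; split=> [[D HD]|[D HD]]; first exact: retract_representable HD.
by exists D; apply: functor_retract_of_iso.
Qed.
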